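(* Let $\mathbb{K} \in \{\mathbb{R}, \mathbb{C}\}$, $k \ge 2$ and let $\tau \in \mathbb{K}^{[n]^k}$ be a tensor. Then for all $\boldsymbol{x}_1, \ldots, \boldsymbol{x}_k \in \mathbb{K}^n$ $$|\tau(\boldsymbol{x}_1, \ldots, \boldsymbol{x}_k)| \le \lambda_{\max}(\tau)\,\|\boldsymbol{x}_1\|\cdots\|\boldsymbol{x}_k\|.$$ In particular, a directed $k$-graph $H=([n],E)$ with edge density $p=|E|/n^k$ satisfies $$\bigl| e(S_1, \ldots, S_k) - p|S_1|\cdots|S_k| \bigr| \le \lambda_2(H)\sqrt{|S_1|\cdots|S_k|} \qquad \text{for all } S_1, \ldots, S_k \subseteq [n],$$ and in particular, for every $\varepsilon>0$, if $H$ satisfies $\mathrm{Eig}(\varepsilon)$ then $H$ satisfies $\mathrm{Disc}(\varepsilon)$.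
   Context: Let $[n]=\{1,\dots,n\}$. A tensor $\tau=(\tau_{i_1\cdots i_k})\in\mathbb{K}^{[n]^k}$ acts as a $k$-linear form $\tau(\boldsymbol{u}_1,\ldots,\boldsymbol{u}_k)=\sum_{i_1,\ldots,i_k\in[n]}\tau_{i_1\cdots i_k}\boldsymbol{u}_1(i_1)\cdots\boldsymbol{u}_k(i_k)$ on $\mathbb{K}^n$ (no conjugation). $\|\cdot\|$ is the Euclidean ($\ell^2$) norm on $\mathbb{K}^n$. The top eigenvalue of $\tau$ is $\lambda_{\max}(\tau)=\sup|\tau(\boldsymbol{u}_1,\ldots,\boldsymbol{u}_k)|$ over all $\boldsymbol{u}_1,\ldots,\boldsymbol{u}_k\in\mathbb{K}^n$ with $\|\boldsymbol{u}_1\|=\cdots=\|\boldsymbol{u}_k\|=1$. A directed $k$-graph is $H=([n],E)$ where $E$ is a set of $k$-tuples of pairwise distinct elements of $[n]$. Its adjacency tensor $\tau_H\in\mathbb{R}^{[n]^k}$ has entry $1$ at $(i_1,\ldots,i_k)$ if $(i_1,\ldots,i_k)\in E$ and $0$ otherwise. With $p=|E|/n^k$ and $\boldsymbol{1}^{\otimes k}$ the all-ones tensor, the second eigenvalue of $H$ is $\lambda_2(H)=\lambda_{\max}(\tau_H-p\boldsymbol{1}^{\otimes k})$ (with $\mathbb{K}=\mathbb{R}$). For $S_1,\ldots,S_k\subseteq[n]$, $e(S_1,\ldots,S_k)$ is the number of edges $(i_1,\ldots,i_k)\in E$ with $i_\ell\in S_\ell$ for all $\ell\in[k]$. $\mathrm{Disc}(\delta)$: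 there is a $q\in[0,1]$ such that $|e(S_1,\ldots,S_k)-q|S_1|\cdots|S_k||\le\delta n^k$ for all $S_1,\ldots,S_k\subseteq[n]$. $\mathrm{Eig}(\varepsilon)$: $\lambda_2(H)\le\varepsilon n^{k/2}$. *)

(* Defs.v *)
From HB Require Import structures.
From mathcomp Require Import all_boot all_order all_algebra.
From mathcomp Require Import complex.
From mathcomp Require Import classical_sets reals exp.

Set Implicit Arguments.
Unset Strict Implicit.
Unset Printing Implicit Defensive.

Import Order.TTheory GRing.Theory Num.Theory.

Local Open Scope ring_scope.
Local Open Scope complex_scope.

Section Scalars.
Variable R : realType.

Variant base_field := RealScalars | ComplexScalars.

Definition scalars (F : base_field) : numFieldType :=
  match F with RealScalars => R | ComplexScalars => R[i] end.

(* The norm `|z| of z : R[i] is itself an element of R[i]; normc is its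
   R-valued version. *)
Definition modulus (F : base_field) : scalars F -> R :=
  match F return scalars F -> R with
  | RealScalars => fun x : R => `|x|
  | ComplexScalars => fun z : R[i] => Normc.normc z
  end.

(* The library's canonical norm on matrices is the sup norm, hence an explicit
   Euclidean norm. *)
Definition norm2 (F : base_field) (n : nat) (x : 'rV[scalars F]_n) : R :=
  Num.sqrt (\sum_(j < n) modulus (x 0 j) ^+ 2).

End Scalars.

Section Tensors.
Variables (R : realType) (F : base_field) (n k : nat).

(* A multi-index (i_1, ..., i_k) in [n]^k is an element of {ffun 'I_k -> 'I_n},
   with [n] and [k] rendered as 'I_n and 'I_k. *)
Definition tensor := {ffun {ffun 'I_k -> 'I_n} -> scalars R F}.

Definition multilinear_form (tau : tensor) (u : 'I_k -> 'rV[scalars R F]_n)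
    : scalars R F :=
  \sum_(i : {ffun 'I_k -> 'I_n}) tau i * \prod_(l < k) u l 0 (i l).

(* For n = 0 there are no unit vectors and the supremum of the empty set is 0
   by convention. *)
Definition lambda_max (tau : tensor) : R :=
  sup [set modulus (multilinear_form tau u)
      | u in [set u : 'I_k -> 'rV[scalars R F]_n |
               forall l, norm2 (u l) = 1]]%classic.

(* c times the all-ones tensor *)
Definition constant_tensor (c : scalars R F) : tensor := [ffun=> c].

End Tensors.

Arguments constant_tensor {R} F n k c.

Record dkgraph (n k : nat) := DKGraph {
  edges : {set {ffun 'I_k -> 'I_n}};
  edges_injective : forall e, e \in edges -> injective e
}.

Section DirectedGraphs.
Variables (R : realType) (n k : nat) (H : dkgraph n k).

Definition adjacency_tensor : tensor R RealScalars n k :=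
  [ffun i => (i \in edges H)%:R].

Definition density : R := #|edges H|%:R / n%:R ^+ k.

Definition lambda2 : R :=
  lambda_max (adjacency_tensor - constant_tensor RealScalars n k density).

Definition edge_count (S : 'I_k -> {set 'I_n}) : nat :=
  #|[set e in edges H | [forall l, e l \in S l]]|.

Definition Disc (delta : R) : Prop :=
  exists q : R, 0 <= q <= 1 /\
    forall S : 'I_k -> {set 'I_n},
      `|(edge_count S)%:R - q * \prod_(l < k) #|S l|%:R| <= delta * n%:R ^+ k.

Definition Eig (epsilon : R) : Prop :=
  lambda2 <= epsilon * n%:R `^ (k%:R / 2).

End DirectedGraphs.

Arguments density R {n k} H.
Arguments lambda2 R {n k} H.

(* Main.v *)
Require Import Defs.
From mathcomp Require Import all_boot all_order all_algebra.
From mathcomp Require Import complex.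
From mathcomp Require Import classical_sets reals exp.

Import Order.TTheory GRing.Theory Num.Theory.
Local Open Scope ring_scope.

(** Rescaling the [x l] to unit vectors bounds the form by [lambda_max], the
    supremum being finite because the entries of unit vectors have modulus at
    most 1. Evaluating the form of [adjacency_tensor - density] at the indicator
    vectors of the sets [S l] gives the mixing bound, and [Disc] follows with
    [q := density], since [#|S l| <= n] bounds the square root by [n ^ (k / 2)]. *)

Section Modulus.
Variables (R : realType) (F : base_field).
Implicit Types (a b : scalars R F) (r : R).

(** Normalising a vector multiplies it by the inverse of its norm, a real number that must first be
    viewed as a scalar of the base field. *)
Definition scalar_of_real (r : R) : scalars R F :=
  match F return scalars R F with
  | RealScalars => r
  | ComplexScalars => real_complex R r
  end.

Lemma modulus_ge0 a : 0 <= modulus a.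
Proof.
case: F a => [a|[x y]] /=; first exact: normr_ge0.
exact: sqrtr_ge0.
Qed.

Lemma modulus0 : modulus (0 : scalars R F) = 0.
Proof. by case: F; [exact: normr0 | exact: Normc.normc0]. Qed.

Lemma modulus1 : modulus (1 : scalars R F) = 1.
Proof. by case: F; [exact: normr1 | exact: Normc.normc1]. Qed.

Lemma modulus_eq0 a : modulus a = 0 -> a = 0.
Proof. by case: F a => [|] a; [move/normr0P/eqP | exact: Normc.eq0_normc]. Qed.

Lemma modulusM a b : modulus (a * b) = modulus a * modulus b.
Proof. by case: F a b => [|] a b; [exact: normrM | exact: Normc.normcM]. Qed.

Lemma le_modulusD a b : modulus (a + b) <= modulus a + modulus b.
Proof. by case: F a b => [|] a b; [exact: ler_normD | exact: le_normcD]. Qed.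

Lemma modulus_scalar_of_real r : modulus (scalar_of_real r) = `|r|.
Proof.
by rewrite /scalar_of_real; case: F => //=; rewrite expr0n /= addr0 sqrtr_sqr.
Qed.

Lemma modulus_prod (I : finType) (f : I -> scalars R F) :
  modulus (\prod_i f i) = \prod_i modulus (f i).
Proof. exact: (big_morph _ modulusM modulus1). Qed.

Lemma le_modulus_sum (I : finType) (f : I -> scalars R F) :
  modulus (\sum_i f i) <= \sum_i modulus (f i).
Proof.
elim/big_ind2: _ => [|a r b s ar bs|//]; first by rewrite modulus0.
exact: le_trans (le_modulusD _ _) (lerD ar bs).
Qed.

End Modulus.

Section Norm2.
Variables (R : realType) (F : base_field) (n : nat).
Implicit Types (x : 'rV[scalars R F]_n).

Lemma sum_sqr_modulus_ge0 x : 0 <= \sum_(j < n) modulus (x 0 j) ^+ 2.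
Proof. by apply: sumr_ge0 => j _; exact: sqr_ge0. Qed.

Lemma norm2_ge0 x : 0 <= norm2 x.
Proof. exact: sqrtr_ge0. Qed.

Lemma modulus_le_norm2 x j : modulus (x 0 j) <= norm2 x.
Proof.
rewrite -[leLHS]ger0_norm ?modulus_ge0 // -sqrtr_sqr ler_wsqrtr //.
by rewrite (bigD1 j) //= lerDl sumr_ge0 // => i _; exact: sqr_ge0.
Qed.

Lemma norm2_eq0 x : norm2 x = 0 -> x = 0.
Proof.
move=> x0; apply/rowP => j; rewrite mxE; apply: modulus_eq0.
by apply/le_anti; rewrite modulus_ge0 andbT -x0 modulus_le_norm2.
Qed.

Lemma norm2Z a x : norm2 (a *: x) = modulus a * norm2 x.
Proof.
rewrite /norm2 -[in RHS](ger0_norm (modulus_ge0 _ _ a)) -sqrtr_sqr -sqrtrM ?sqr_ge0 //.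
congr (Num.sqrt _); rewrite mulr_sumr; apply: eq_bigr => j _.
by rewrite mxE modulusM exprMn.
Qed.

End Norm2.

Section MultilinearForm.
Variables (R : realType) (F : base_field) (n k : nat).
Implicit Types (tau : tensor R F n k) (x u : 'I_k -> 'rV[scalars R F]_n).

Lemma multilinear_formZ tau (a : 'I_k -> scalars R F) x :
  multilinear_form tau (fun l => a l *: x l)
  = (\prod_l a l) * multilinear_form tau x.
Proof.
rewrite /multilinear_form mulr_sumr; apply: eq_bigr => i _.
rewrite mulrCA -big_split /=; congr (_ * _).
by apply: eq_bigr => l _; rewrite mxE.
Qed.

Lemma multilinear_form_eq0 tau x l : x l = 0 -> multilinear_form tau x = 0.
Proof.
move=> xl0; rewrite /multilinear_form big1 // => i _.
by rewrite (bigD1 l) //= xl0 mxE mul0r mulr0.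
Qed.

Lemma modulus_form_le_lambda_max tau u :
  (forall l, norm2 (u l) = 1) ->
  modulus (multilinear_form tau u) <= lambda_max tau.
Proof.
move=> u1; apply: ub_le_sup; last by exists u.
(* The witness is the entrywise l1 norm of [tau]: each product of coordinates of unit vectors has
   modulus at most 1. *)
exists (\sum_i modulus (tau i)) => _ [v v1 <-].
apply: le_trans (le_modulus_sum _ _ _ _) _; apply: ler_sum => i _.
rewrite modulusM modulus_prod ler_piMr ?modulus_ge0 //.
apply: prodr_ile1 => l _; rewrite modulus_ge0 /= -(v1 l).
exact: modulus_le_norm2.
Qed.

Lemma modulus_form_le tau x :
  modulus (multilinear_form tau x) <= lambda_max tau * \prod_(l < k) norm2 (x l).
Proof.
(* A vector of norm 0 cannot be normalised, but it makes both sides vanish. *)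
have [/existsP[l /eqP xl0]|/existsPn x0] :=
    boolP [exists l : 'I_k, norm2 (x l) == 0].
  rewrite (multilinear_form_eq0 _ _ _ (norm2_eq0 _ _ _ _ xl0)) modulus0.
  by rewrite (bigD1 l) //= xl0 mul0r mulr0.
have prod_gt0 : 0 < \prod_(l < k) norm2 (x l).
  by apply: prodr_gt0 => l _; rewrite lt_neqAle eq_sym x0 norm2_ge0.
(* After division by the product of the norms, the inverse norms are moduli of scalars, so they move
   inside the modulus and, by multilinearity, into the arguments of the form, which become unit
   vectors. *)
rewrite -ler_pdivrMr // mulrC -prodfV.
have modV l : modulus (scalar_of_real R F (norm2 (x l))^-1) = (norm2 (x l))^-1.
  by rewrite modulus_scalar_of_real ger0_norm // invr_ge0 norm2_ge0.
under eq_bigr do rewrite -modV.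
rewrite -modulus_prod -modulusM -multilinear_formZ.
by apply: modulus_form_le_lambda_max => l; rewrite norm2Z modV mulVf.
Qed.

End MultilinearForm.

Section Discrepancy.
Variables (R : realType) (n k : nat) (H : dkgraph n k).
Implicit Types S : 'I_k -> {set 'I_n}.

Definition indicator_vectors S (l : 'I_k) : 'rV[scalars R RealScalars]_n :=
  \row_j (j \in S l)%:R.

Lemma norm2_indicator S l :
  norm2 (indicator_vectors S l) = Num.sqrt (#|S l|%:R : R).
Proof.
congr (Num.sqrt _); rewrite -sum1_card natr_sum [RHS]big_mkcond /=.
apply: eq_bigr => j _; rewrite mxE.
by case: (j \in S l); rewrite /= ?normr1 ?normr0 ?expr1n ?expr0n.
Qed.

Lemma prod_mem_nat S (i : {ffun 'I_k -> 'I_n}) :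
  \prod_(l < k) (i l \in S l)%:R = [forall l, i l \in S l]%:R :> R.
Proof.
have [/forallP iS|/forallPn[l iSl]] := boolP [forall l, i l \in S l].
  by rewrite big1 // => l _; rewrite iS.
by rewrite (bigD1 l) //= (negbTE iSl) mul0r.
Qed.

(** Both terms on the right are sums over all multi-indices weighted by the indicator of the box
    given by [S], so they subtract entrywise. *)
Lemma multilinear_form_indicator S :
  multilinear_form (adjacency_tensor R H
    - constant_tensor RealScalars n k (density R H)) (indicator_vectors S)
  = (edge_count H S)%:R - density R H * \prod_(l < k) #|S l|%:R.
Proof.
(* Each [#|S l|] is a sum of 0/1 values; distributing the product over these sums counts the
   multi-indices in the box. *)
have -> : \prod_(l < k) #|S l|%:R
    = \sum_(i : {ffun 'I_k -> 'I_n}) \prod_(l < k) (i l \in S l)%:R :> R.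
  rewrite -(bigA_distr_bigA (fun l j => (j \in S l)%:R)).
  apply: eq_bigr => l _; rewrite -sum1_card natr_sum big_mkcond /=.
  by apply: eq_bigr => j _; case: (j \in S l).
have -> : (edge_count H S)%:R = \sum_(i : {ffun 'I_k -> 'I_n})
    (i \in edges H)%:R * \prod_(l < k) (i l \in S l)%:R :> R.
  rewrite /edge_count -sum1_card natr_sum big_mkcond /=.
  apply: eq_bigr => i _; rewrite inE prod_mem_nat -natrM mulnb.
  by case: (_ && _).
rewrite mulr_sumr -sumrB; apply: eq_bigr => i _.
rewrite !ffunE -mulrBl; congr (_ * _).
by apply: eq_bigr => l _; rewrite mxE.
Qed.

Lemma expander_mixing S :
  `|(edge_count H S)%:R - density R H * \prod_(l < k) #|S l|%:R|
    <= lambda2 R H * Num.sqrt (\prod_(l < k) #|S l|%:R).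
Proof.
have -> : Num.sqrt (\prod_(l < k) #|S l|%:R)
    = \prod_(l < k) norm2 (indicator_vectors S l) :> R.
  elim/big_rec2: _ => [|l _ y _ <-]; first by rewrite sqrtr1.
  by rewrite sqrtrM // norm2_indicator.
rewrite -multilinear_form_indicator.
(* Over [RealScalars] the modulus is the absolute value by conversion. *)
exact: (modulus_form_le R RealScalars).
Qed.

Lemma density_itv : 0 <= density R H <= 1.
Proof.
rewrite /density divr_ge0 ?exprn_ge0 //= -natrX.
have EH : (#|edges H| <= n ^ k)%N.
  by apply: leq_trans (max_card _) _; rewrite card_ffun !card_ord.
(* If [n ^ k] is 0, the convention that the inverse of 0 is 0 makes the density 0. *)
have [->|nk0] := posnP (n ^ k)%N; first by rewrite invr0 mulr0.
by rewrite ler_pdivrMr ?ltr0n // mul1r ler_nat.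
Qed.

Lemma Eig_Disc (epsilon : R) : (0 < k)%N -> 0 < epsilon ->
  Eig H epsilon -> Disc H epsilon.
Proof.
move=> k0 e0 eig; exists (density R H); split; first exact: density_itv.
move=> S; apply: le_trans (expander_mixing S) _.
apply: le_trans (ler_wpM2r (sqrtr_ge0 _) eig) _.
(* Cancel [epsilon] and read the real power [n ^ (k / 2)] as the square root of [n ^ k]. *)
rewrite -mulrA ler_pM2l // powRrM powR_mulrn // powR12_sqrt ?exprn_ge0 //.
have nk0 : 0 <= n%:R ^+ k :> R by rewrite exprn_ge0.
(* Writing [n ^ k] on the right as the square of its root cancels one factor and leaves a comparison
   of the product of the [#|S l|] with [n ^ k], done factor by factor. *)
rewrite -[leRHS]sqr_sqrtr // expr2 ler_wpM2l ?sqrtr_ge0 // ler_wsqrtr //.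
have -> : n%:R ^+ k = \prod_(l < k) n%:R :> R by rewrite prodr_const card_ord.
apply: ler_prod => l _; rewrite ler0n ler_nat.
by apply: leq_trans (max_card _) _; rewrite card_ord.
Qed.

End Discrepancy.

Theorem proposition2 (R : realType) (n k : nat) (hk : (2 <= k)%N) :
  (forall (F : base_field) (tau : tensor R F n k)
      (x : 'I_k -> 'rV[scalars R F]_n),
     modulus (multilinear_form tau x)
       <= lambda_max tau * \prod_(l < k) norm2 (x l)) /\
  (forall H : dkgraph n k,
     (forall S : 'I_k -> {set 'I_n},
        `|(edge_count H S)%:R - density R H * \prod_(l < k) #|S l|%:R|
          <= lambda2 R H * Num.sqrt (\prod_(l < k) #|S l|%:R)) /\
     (forall epsilon : R, 0 < epsilon -> Eig H epsilon -> Disc H epsilon)).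
Proof.
split=> [F tau x|H]; first exact: modulus_form_le.
split=> [S|epsilon e0]; first exact: expander_mixing.
by apply: Eig_Disc => //; exact: ltnW.
Qed.
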